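(* Let $p<q<r$ be odd primes such that $r=\alpha p+\beta q\le\varphi(pq)$ for some integers $\alpha,\beta>0$. Let $p'\in\{1,2,\ldots,q-1\}$ be the inverse of $p$ modulo $q$ and let $q'\in\{1,2,\ldots,p-1\}$ be the inverse of $q$ modulo $p$. Then $$C(pqr)=\max\left\{\min\left\{\left\lceil\frac{p'}{\alpha}\right\rceil,\left\lceil\frac{q'}{\beta}\right\rceil\right\},\ \min\left\{\left\lceil\frac{q-p'}{\alpha}\right\rceil,\left\lceil\frac{p-q'}{\beta}\right\rceil\right\}\right\}.$$
   Context: $\varphi$ is Euler's totient function. $\Phi_n(x)=\prod_{1\le k\le n,\ (k,n)=1}(x-e^{2k\pi i/n})$ is the $n$th cyclotomic polynomial, and the $n$th inverse cyclotomic polynomial is $\Psi_n(x)=\dfrac{x^n-1}{\Phi_n(x)}$. The height of a polynomial is the maximal absolute value of its coefficients; $C(n)$ denotes the height of $\Psi_n$. *)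

(* Defs.v *)
From mathcomp Require Import all_boot all_order all_algebra all_field.

Set Implicit Arguments.
Unset Strict Implicit.
Unset Printing Implicit Defensive.

Import Order.TTheory GRing.Theory Num.Theory.
Local Open Scope ring_scope.

(* The divisor is monic, so %/ is the Euclidean quotient in {poly int}; it is
   exact for n > 0, see inv_CyclotomicK. *)
Definition inv_Cyclotomic (n : nat) : {poly int} := ('X^n - 1) %/ 'Phi_n.

Definition poly_height (f : {poly int}) : nat := \max_(i < size f) `|(f`_i)%R|%N.

Definition inv_Cyclotomic_height (n : nat) : nat :=
  poly_height (inv_Cyclotomic n).

Lemma inv_CyclotomicK (n : nat) :
  (0 < n)%N -> inv_Cyclotomic n * 'Phi_n = 'X^n - 1.
Proof.
move=> n_gt0; rewrite /inv_Cyclotomic.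
rewrite -[in LHS](prod_Cyclotomic n_gt0) -[in RHS](prod_Cyclotomic n_gt0).
rewrite (big_rem n) -?dvdn_divisors //= mulrC.
rewrite [X in _ * (X %/ _)]mulrC Pdiv.IdomainMonic.mulpK ?Cyclotomic_monic //.
Qed.

(* Main.v *)
(* Psi_pqr(x) = Phi_pq(x) (1 + x^r + ... + x^(r(p-1))) (x^(rq) - 1), and
   Phi_pq(x) = sum_(i < p', j < q') x^(ip + jq)
               - x sum_(i < q - p', j < p - q') x^(ip + jq).
   Since r = alpha p + beta q, two exponents of one of these double sums that
   are congruent modulo r lie on a progression (i + m alpha, j + m beta) inside
   the rectangle of indices, whose length is at most the corresponding minimum
   of ceilings. Exponents of the two different double sums are never congruent
   modulo r, so no coefficient of Psi_pqr exceeds the larger of the two minima.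
   The progressions starting at the corner (0, 0) of each rectangle attain the
   two bounds. *)
Require Import Defs.
From mathcomp Require Import all_boot all_order all_algebra all_field.
From mathcomp Require Import zify ring.

Set Implicit Arguments.
Unset Strict Implicit.
Unset Printing Implicit Defensive.

Import Order.TTheory GRing.Theory Num.Theory.
Local Open Scope ring_scope.

(** * Factorizations of X^n - 1 for n a product of at most three distinct primes *)

Lemma divisors1 : divisors 1 = [:: 1%N]. Proof. by []. Qed.

Lemma divisors_mulp (n p : nat) : (0 < n)%N -> prime p -> ~~ (p %| n)%N ->
  perm_eq (divisors (n * p)) (divisors n ++ [seq (d * p)%N | d <- divisors n]).
Proof.
move=> n_gt0 p_pr pNn; have p_gt0 := prime_gt0 p_pr.
have inj_p : injective (muln^~ p) by move=> x y /eqP; rewrite eqn_pmul2r // => /eqP.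
apply: uniq_perm; rewrite ?divisors_uniq // ?cat_uniq ?(map_inj_uniq inj_p).
  rewrite !divisors_uniq /= andbT; apply/hasPn => _ /mapP[d _ ->].
  rewrite /= -dvdn_divisors //; apply: contra pNn.
  exact/dvdn_trans/dvdn_mull.
move=> d; rewrite mem_cat -!dvdn_divisors ?muln_gt0 ?n_gt0 //.
apply/idP/orP => [d_np | [d_n | /mapP[e]]]; last 2 first.
- exact: dvdn_mulr.
- by rewrite -dvdn_divisors // => e_n ->; rewrite dvdn_pmul2r.
have [/dvdnP[e d_ep] | pNd] := boolP (p %| d)%N.
  right; apply/mapP; exists e => //; rewrite -dvdn_divisors //.
  by rewrite d_ep dvdn_pmul2r in d_np.
by left; rewrite -(@Gauss_dvdl d n p) // coprime_sym prime_coprime.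
Qed.

(** The divisors of n p that are prime to p are those of n, and their cyclotomic factors multiply to
    X^n - 1. Adjoining one prime at a time gives the identities below. *)
Lemma prod_Cyclotomic_mulp (n p : nat) :
    (0 < n)%N -> prime p -> ~~ (p %| n)%N ->
  ('X^n - 1) * \prod_(d <- divisors n) 'Phi_(d * p) = 'X^(n * p) - 1.
Proof.
move=> n_gt0 p_pr pNn; rewrite -!prod_Cyclotomic ?muln_gt0 ?n_gt0 ?prime_gt0 //.
by rewrite (perm_big _ (divisors_mulp n_gt0 p_pr pNn)) big_cat big_map.
Qed.

Lemma subX1_neq0 (n : nat) : (0 < n)%N -> 'X^n - 1 != 0 :> {poly int}.
Proof. by move=> n_gt0; rewrite -size_poly_eq0 size_XnsubC. Qed.

Lemma Cyclotomic_prime_mul (p : nat) : prime p ->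
  ('X - 1) * 'Phi_p = 'X^p - 1.
Proof.
move=> p_pr; have := @prod_Cyclotomic_mulp 1 p isT p_pr.
by rewrite divisors1 big_seq1 !mul1n dvdn1 neq_ltn prime_gt1 ?orbT // => ->.
Qed.

Lemma Cyclotomic_prime2_mul (p q : nat) : prime p -> prime q -> p != q ->
  ('X^p - 1) * ('Phi_q * 'Phi_(p * q)) = 'X^(p * q) - 1.
Proof.
move=> p_pr q_pr neq_pq.
have qNp : ~~ (q %| p)%N by rewrite dvdn_prime2 // eq_sym.
rewrite -(prod_Cyclotomic_mulp (prime_gt0 p_pr) q_pr qNp) -[in divisors p](mul1n p).
rewrite (perm_big _ (@divisors_mulp 1 p _ p_pr _)) //; last first.
  by rewrite dvdn1 neq_ltn prime_gt1 ?orbT.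
by rewrite divisors1 /= big_cons big_seq1 !mul1n.
Qed.

Lemma Cyclotomic_prime3_mul (p q r : nat) :
    prime p -> prime q -> prime r -> p != q -> p != r -> q != r ->
  ('X^(p * q) - 1) * ('Phi_r * 'Phi_(p * r) * 'Phi_(q * r) * 'Phi_(p * q * r))
    = 'X^(p * q * r) - 1.
Proof.
move=> p_pr q_pr r_pr neq_pq neq_pr neq_qr.
have qNp : ~~ (q %| p)%N by rewrite dvdn_prime2 // eq_sym.
have rNpq : ~~ (r %| p * q)%N.
  by rewrite Euclid_dvdM // !dvdn_prime2 // negb_or ![r == _]eq_sym neq_pr.
have pq_gt0 : (0 < p * q)%N by rewrite muln_gt0 !prime_gt0.
have pN1 : ~~ (p %| 1)%N by rewrite dvdn1 neq_ltn prime_gt1 ?orbT.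
rewrite -(prod_Cyclotomic_mulp pq_gt0 r_pr rNpq); congr (_ * _).
rewrite (perm_big _ (divisors_mulp (prime_gt0 p_pr) q_pr qNp)) big_cat big_map.
rewrite -[in divisors p](mul1n p).
rewrite !(perm_big _ (@divisors_mulp 1 p isT p_pr pN1)) divisors1 /=.
by rewrite !(big_cons, big_nil) !mul1n; ring.
Qed.

(** * Geometric sums and product formulas for Phi_pq and Psi_pqr *)

Definition geom (d n : nat) : {poly int} := \sum_(i < n) 'X^(d * i).

Lemma geomE (d n : nat) : ('X^d - 1) * geom d n = 'X^(d * n) - 1.
Proof.
by rewrite exprM [RHS]subrX1; congr (_ * _); apply: eq_bigr => i _; rewrite exprM.
Qed.

(** After multiplication by (X^p - 1)(X^q - 1) the geometric sums telescope, and both sides become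
    (X - 1)(X^(pq) - 1). *)
Lemma Cyclotomic_pqE (p q p' q' : nat) :
    prime p -> prime q -> p != q -> (p' <= q)%N -> (q' <= p)%N ->
    (p * p' + q * q' = (p * q).+1)%N ->
  'Phi_(p * q) = geom p p' * geom q q' - 'X * (geom p (q - p') * geom q (p - q')).
Proof.
move=> p_pr q_pr neq_pq le_p' le_q' bez.
have D : ('X^p - 1) * ('X^q - 1) != 0 :> {poly int}.
  by rewrite mulf_neq0 ?subX1_neq0 ?prime_gt0.
apply: (mulfI D).
transitivity (('X - 1) * ('X^(p * q) - 1) : {poly int}).
  rewrite -(Cyclotomic_prime2_mul p_pr q_pr neq_pq) -(Cyclotomic_prime_mul q_pr).
  ring.
transitivity ((('X^p - 1) * geom p p') * (('X^q - 1) * geom q q')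
  - 'X * ((('X^p - 1) * geom p (q - p')) * (('X^q - 1) * geom q (p - q')))); last by ring.
rewrite !geomE.
have le_pp' : (p * p' <= p * q)%N by rewrite leq_mul2l le_p' orbT.
have le_qq' : (q * q' <= p * q)%N by rewrite mulnC leq_mul2r le_q' orbT.
(* The relation [bez] gives 1 + p(q - p') = q q' and 1 + q(p - q') = p p', so the terms X^(p p') and
   X^(q q') cancel in the expansion. *)
have e1 : 'X * 'X^(p * (q - p')) = 'X^(q * q') :> {poly int}.
  by rewrite -exprS; congr (_ ^+ _); rewrite mulnBr ?[(q * p)%N]mulnC; lia.
have e2 : 'X * 'X^(q * (p - q')) = 'X^(p * p') :> {poly int}.
  by rewrite -exprS; congr (_ ^+ _); rewrite mulnBr ?[(q * p)%N]mulnC; lia.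
have e3 : 'X^(p * p') * 'X^(q * q') = 'X * 'X^(p * q) :> {poly int}.
  by rewrite -exprD bez exprS.
have e4 : 'X^(q * q') * 'X^(q * (p - q')) = 'X^(p * q) :> {poly int}.
  by rewrite -exprD -mulnDr subnKC // mulnC.
transitivity ('X^(p * p') * 'X^(q * q') - 'X^(p * p') - 'X^(q * q') + 1
  - (('X * 'X^(p * (q - p'))) * 'X^(q * (p - q')) - 'X * 'X^(p * (q - p'))
     - 'X * 'X^(q * (p - q')) + 'X) : {poly int}); last by ring.
rewrite e1 e2 e3 e4; ring.
Qed.

(** After multiplication by (X^r - 1) Phi_pqr both sides are the product of all Phi_d with d | pqr,
    times Phi_1 Phi_r. *)
Lemma inv_Cyclotomic_pqrE (p q r : nat) :
    prime p -> prime q -> prime r -> p != q -> p != r -> q != r ->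
  inv_Cyclotomic (p * q * r) = 'Phi_(p * q) * geom r p * ('X^(r * q) - 1).
Proof.
move=> p_pr q_pr r_pr neq_pq neq_pr neq_qr.
have pqr_gt0 : (0 < p * q * r)%N by rewrite !muln_gt0 !prime_gt0.
have D : ('X^r - 1) * 'Phi_(p * q * r) != 0.
  by rewrite mulf_neq0 ?subX1_neq0 ?monic_neq0 ?Cyclotomic_monic ?prime_gt0.
apply: (mulIf D).
rewrite mulrCA inv_CyclotomicK // [RHS]mulrC.
transitivity ('Phi_(p * q * r) * 'Phi_(p * q) * (('X^r - 1) * geom r p)
  * ('X^(r * q) - 1)); last by ring.
rewrite geomE ![(r * _)%N]mulnC -Cyclotomic_prime3_mul //.
rewrite -(Cyclotomic_prime2_mul p_pr r_pr neq_pr).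
rewrite -(Cyclotomic_prime2_mul q_pr r_pr neq_qr).
rewrite -(Cyclotomic_prime2_mul p_pr q_pr neq_pq).
rewrite -(Cyclotomic_prime_mul p_pr) -(Cyclotomic_prime_mul q_pr).
rewrite -(Cyclotomic_prime_mul r_pr); ring.
Qed.

(** * Coefficients of Psi_pqr as counts of representations of the exponent *)

Definition hits (p q r u v w t k : nat) : {set 'I_u * 'I_v * 'I_w} :=
  [set x : 'I_u * 'I_v * 'I_w | (p * x.1.1 + q * x.1.2 + r * x.2 + t == k)%N].

Lemma hits_eq0 (p q r u v w t k : nat) :
  (k < t)%N -> #|hits p q r u v w t k| = 0%N.
Proof.
move=> lt_kt; apply: eq_card0 => x; rewrite inE; apply/eqP => e.
by move: lt_kt; rewrite -e ltnNge leq_addl.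
Qed.

Lemma coef_geom3 (p q r u v w t k : nat) :
  (geom p u * geom q v * geom r w * 'X^t)`_k = #|hits p q r u v w t k|%:Z.
Proof.
rewrite /geom big_distrlr /= pair_bigA /= big_distrlr /= pair_bigA /=.
rewrite big_distrl /= coef_sum -sum1_card -natz natr_sum [RHS]big_mkcond /=.
apply: eq_bigr => x _; rewrite -!exprD coefXn inE eq_sym.
by case: eqP.
Qed.

(** The four counts pair the two products in [Cyclotomic_pqE] with the two terms of X^(rq) - 1; the
    factor X of the second product is the extra offset 1. *)
Lemma coef_inv_Cyclotomic_pqr (p q r p' q' k : nat) :
    prime p -> prime q -> prime r -> p != q -> p != r -> q != r ->
    (p' <= q)%N -> (q' <= p)%N -> (p * p' + q * q' = (p * q).+1)%N ->
  (inv_Cyclotomic (p * q * r))`_k =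
    #|hits p q r p' q' p (r * q) k|%:Z - #|hits p q r p' q' p 0 k|%:Z
    + #|hits p q r (q - p') (p - q') p 1 k|%:Z
    - #|hits p q r (q - p') (p - q') p (r * q).+1 k|%:Z.
Proof.
move=> p_pr q_pr r_pr neq_pq neq_pr neq_qr le_p' le_q' bez.
rewrite inv_Cyclotomic_pqrE // (Cyclotomic_pqE p_pr q_pr neq_pq le_p' le_q' bez).
rewrite -!coef_geom3 -!coefB -coefD -coefB; congr (polyseq _)`_k.
by rewrite [in RHS](exprS 'X (r * q)); ring.
Qed.

(** * Representations of an integer by p, q and r = alpha p + beta q *)

Lemma lin_comb_coprime (p q : nat) (x y c : int) : (0 < p)%N -> (0 < q)%N ->
    coprime p q -> p%:Z * x + q%:Z * y = c * (p * q)%:Z ->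
  exists t : int, x = t * q%:Z /\ y = (c - t) * p%:Z.
Proof.
move=> p_gt0 q_gt0 co_pq e.
have : (q%:Z %| p%:Z * x)%Z.
  apply/dvdzP; exists (c * p%:Z - y); rewrite PoszM in e; lia.
rewrite Gauss_dvdzr; last by rewrite /coprimez gcdzC; apply/eqP; congr Posz; apply/eqP.
case/dvdzP=> t xE; exists t; split=> //.
apply: (@mulfI _ q%:Z); first by rewrite lt0r_neq0.
rewrite xE PoszM in e; transitivity (c * (p%:Z * q%:Z) - p%:Z * (t * q%:Z)); first by rewrite -e; ring.
ring.
Qed.

Section Hits.

Variables (p q alpha beta : nat).
Hypotheses (p_gt0 : (0 < p)%N) (q_gt0 : (0 < q)%N) (co_pq : coprime p q).
Hypotheses (alpha_gt0 : (0 < alpha)%N) (beta_gt0 : (0 < beta)%N).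

Let r := (alpha * p + beta * q)%N.

(** Substituting for r turns the difference of two representations into an instance of
    [lin_comb_coprime] with c = 0, which leaves a multiple t of (q, -p). *)
Lemma hits_shift (i j m i' j' m' : nat) :
    (i < q)%N -> (j < p)%N -> (i' < q)%N -> (j' < p)%N -> (m' <= m)%N ->
    (p * i + q * j + r * m = p * i' + q * j' + r * m')%N ->
  (i' = i + (m - m') * alpha /\ j' = j + (m - m') * beta)%N.
Proof.
move=> lt_i lt_j lt_i' lt_j' le_m e.
pose d := (m - m')%N; have mE : m = (m' + d)%N by rewrite /d subnKC.
have : p%:Z * (i'%:Z - i%:Z - (d * alpha)%:Z) + q%:Z * (j'%:Z - j%:Z - (d * beta)%:Z)
   = 0 * (p * q)%:Z by rewrite /r mE in e; lia.
case/lin_comb_coprime => // t [xE yE]; rewrite -/d.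
(* As d >= 0, t > 0 would give i' - i >= q, and t < 0 would give j' - j >= p. *)
have : t = 0 by nia.
move=> t0; rewrite t0 in xE yE; lia.
Qed.

(** By [hits_shift] the solutions lie on one progression of step (alpha, beta), so the quotient of
    the first index by alpha, or of the second by beta, separates them. *)
Lemma card_hits_le (u v w t k : nat) : (0 < u <= q)%N -> (0 < v <= p)%N ->
  (#|hits p q r u v w t k| <= minn (u.-1 %/ alpha).+1 (v.-1 %/ beta).+1)%N.
Proof.
case/andP=> u_gt0 le_uq /andP[v_gt0 le_vp]; set H := hits _ _ _ _ _ _ _ _.
have shift x y : x \in H -> y \in H -> (y.2 <= x.2)%N ->
    (y.1.1 = x.1.1 + (x.2 - y.2) * alpha :> nat /\
     y.1.2 = x.1.2 + (x.2 - y.2) * beta :> nat)%N.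
  rewrite !inE => /eqP xk /eqP yk le_yx; apply: hits_shift => //.
  1,3: exact: leq_trans (ltn_ord _) le_uq.
  1,2: exact: leq_trans (ltn_ord _) le_vp.
  by apply/eqP; rewrite -(eqn_add2r t) xk yk.
have card_le (f : 'I_u * 'I_v * 'I_w -> nat) n a : (0 < a)%N -> (0 < n)%N ->
    (forall x, f x < n)%N ->
    (forall x y, x \in H -> y \in H -> y.2 <= x.2 ->
      f y = f x + (x.2 - y.2) * a)%N ->
    (#|H| <= (n.-1 %/ a).+1)%N.
  move=> a_gt0 n_gt0 lt_f f_shift.
  have lt_fa x : (f x %/ a < (n.-1 %/ a).+1)%N.
    by rewrite ltnS leq_div2r // -ltnS prednK.
  have inj_f x y : x \in H -> y \in H -> (y.2 <= x.2)%N ->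
      (f x %/ a = f y %/ a)%N -> x = y.
    (* Here f y %/ a = f x %/ a + (x.2 - y.2), so equal quotients force equal third indices, and
       [shift] then gives the other two. *)
    move=> xH yH le_yx; rewrite (f_shift x y) // divnDMl // => e.
    have d0 : (x.2 - y.2 = 0)%N by lia.
    have [] := shift _ _ xH yH le_yx; rewrite d0 !mul0n !addn0.
    case: x y le_yx d0 {e xH yH} => [[i j] m] [[i' j'] m'] /= le_m d0 ei ej.
    by congr (_, _, _); apply: val_inj => //=; lia.
  rewrite -[X in (_ <= X)%N]card_ord.
  rewrite -(@card_in_imset _ _ (fun x => Ordinal (lt_fa x))); first exact: max_card.
  move=> x y xH yH /(congr1 val) /= e.
  by case: (leqP y.2 x.2) => [|/ltnW] le; [apply: inj_f | apply/esym/inj_f].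
rewrite leq_min; apply/andP; split.
- by apply: (card_le (fun x => x.1.1 : nat)) => // x y xH yH /(shift _ _ xH yH)[].
- by apply: (card_le (fun x => x.1.2 : nat)) => // x y xH yH /(shift _ _ xH yH)[].
Qed.

(** The L + 1 triples (i alpha, i beta, L - i) all represent r L. *)
Lemma card_hits_ge (u v w t L : nat) :
    (0 < u)%N -> (0 < v)%N -> (L < w)%N ->
    (L <= u.-1 %/ alpha)%N -> (L <= v.-1 %/ beta)%N ->
  (L < #|hits p q r u v w t (r * L + t)|)%N.
Proof.
move=> u_gt0 v_gt0 lt_Lw; rewrite !leq_divRL // => le_u le_v.
have lt_u (i : 'I_L.+1) : (i * alpha < u)%N.
  by rewrite -(prednK u_gt0) ltnS (leq_trans _ le_u) // leq_mul2r -ltnS ltn_ord orbT.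
have lt_v (i : 'I_L.+1) : (i * beta < v)%N.
  by rewrite -(prednK v_gt0) ltnS (leq_trans _ le_v) // leq_mul2r -ltnS ltn_ord orbT.
have lt_w (i : 'I_L.+1) : (L - i < w)%N by exact: leq_ltn_trans (leq_subr _ _) lt_Lw.
pose f i := (Ordinal (lt_u i), Ordinal (lt_v i), Ordinal (lt_w i)).
have inj_f : injective f.
  move=> i j [] /eqP; rewrite eqn_pmul2r // => /eqP ij _ _; exact: val_inj.
rewrite -[X in (X <= _)%N]card_ord -(card_imset _ inj_f).
apply/subset_leq_card/subsetP => _ /imsetP[i _ ->].
have le_iL : (i <= L)%N by rewrite -ltnS.
rewrite inE /= eqn_add2r -[X in _ == (r * X)%N](subnKC le_iL) /r.
by apply/eqP; ring.
Qed.

(* The positive and negative monomials of [Phi_pq] lie in different residue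
   classes modulo [r]. *)
Lemma hits_disjoint (p' q' w s s' k : nat) :
    (p' <= q)%N -> (q' <= p)%N -> (p * p' + q * q' = (p * q).+1)%N ->
    (0 < #|hits p q r p' q' w (r * s) k|)%N ->
  #|hits p q r (q - p') (p - q') w (r * s').+1 k| = 0%N.
Proof.
move=> le_p' le_q' bez /card_gt0P[[[i j] m]]; rewrite inE /= => /eqP e.
apply: eq_card0 => [[[i' j'] m']]; rewrite inE /= -e; apply/negbTE/eqP => {}e.
have [lt_i lt_j] := (ltn_ord i, ltn_ord j).
have [lt_i' lt_j'] := (ltn_ord i', ltn_ord j').
move: (i : nat) (j : nat) (m : nat) (i' : nat) (j' : nat) (m' : nat)
  lt_i lt_j lt_i' lt_j' e => {}i {}j {}m {}i' {}j' {}m' lt_i lt_j lt_i' lt_j' e.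
pose d : int := (m + s)%:Z - (m' + s')%:Z.
(* Adding [bez] to the difference of the two representations absorbs the extra offset 1 and leaves p
   q on the right, hence c = 1. *)
have : p%:Z * (i'%:Z + p'%:Z - i%:Z - d * alpha%:Z)
     + q%:Z * (j'%:Z + q'%:Z - j%:Z - d * beta%:Z) = 1 * (p * q)%:Z.
  by rewrite /d /r in e *; lia.
case/lin_comb_coprime => // t [xE yE].
have [dA dB] : (0 < d -> 0 < d * alpha%:Z /\ 0 < d * beta%:Z) /\
    (d <= 0 -> d * alpha%:Z <= 0 /\ d * beta%:Z <= 0).
  by split=> d0; split; rewrite ?mulr_gt0 ?mulr_le0_ge0.
(* The index ranges give 0 < i' + p' - i < q and 0 < j' + q' - j < p. If t > 0, the first forces d <
   0, and then j' + q' - j <= 0; the case t <= 0 is symmetric. *)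
have [t_gt0 | t_le0] := ltrP 0 t.
  have : q%:Z <= t * q%:Z by rewrite ler_peMl.
  have : (1 - t) * p%:Z <= 0 by rewrite mulr_le0_ge0 // subr_le0.
  lia.
have : t * q%:Z <= 0 by rewrite mulr_le0_ge0.
have : p%:Z <= (1 - t) * p%:Z by rewrite ler_peMl // lerDl oppr_ge0.
lia.
Qed.

End Hits.

(** * Heights, ceilings and the Bezout relation *)

Lemma poly_height_ge (f : {poly int}) (k : nat) : (`|(f`_k)%R| <= poly_height f)%N.
Proof.
have [lt_k | le_k] := ltnP k (size f); last by rewrite nth_default.
exact: (leq_bigmax (Ordinal lt_k)).
Qed.

Lemma poly_height_le (f : {poly int}) (h : nat) :
  (forall k, (`|(f`_k)%R| <= h)%N) -> (poly_height f <= h)%N.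
Proof. by move=> le_f; apply/bigmax_leqP => i _. Qed.

(** Identifies the ceilings of the theorem with the progression lengths in [card_hits_le]: both
    count the multiples of b in [0, a). *)
Lemma ceil_natr_div (a b : nat) : (0 < a)%N -> (0 < b)%N ->
  Num.ceil (a%:R / b%:R : rat) = ((a.-1 %/ b).+1)%:Z.
Proof.
move=> a_gt0 b_gt0; apply: ceil_def.
have b_gt0' : 0 < b%:R :> rat by rewrite ltr0n.
rewrite -addn1 PoszD addrK !pmulrn.
rewrite ltr_pdivlMr // ler_pdivrMr // -!natrM ltr_nat ler_nat.
have := divn_eq a.-1 b; have := ltn_pmod a.-1 b_gt0; nia.
Qed.

(** The left side is 1 modulo p q by the Chinese remainder theorem, exceeds 1, and is below 2 p
    q. *)
Lemma bezout_modn (p q p' q' : nat) : coprime p q ->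
    (1 < p)%N -> (1 < q)%N ->
    (1 <= p' <= q - 1)%N -> p * p' = 1 %[mod q] ->
    (1 <= q' <= p - 1)%N -> q * q' = 1 %[mod p] ->
  (p * p' + q * q' = (p * q).+1)%N.
Proof.
move=> co_pq p_gt1 q_gt1 /andP[p'_gt0 le_p'] p'_inv /andP[q'_gt0 le_q'] q'_inv.
have : (p * p' + q * q' == 1 %[mod p * q])%N.
  rewrite chinese_remainder //; apply/andP; split; apply/eqP.
    by rewrite mulnC modnMDl.
  by rewrite addnC [(q * _)%N]mulnC modnMDl.
rewrite eqn_mod_dvd; last by rewrite addn_gt0 muln_gt0 p'_gt0 ltnW.
case/dvdnP=> t e.
have ge_p : (p <= p * p')%N by rewrite leq_pmulr.
have ge_q : (q <= q * q')%N by rewrite leq_pmulr.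
have lt_pp' : (p * p' < p * q)%N by rewrite ltn_pmul2l; lia.
have lt_qq' : (q * q' < p * q)%N by rewrite mulnC ltn_pmul2r; lia.
have t_lt2 : (t < 2)%N by rewrite -(@ltn_pmul2r (p * q)) ?muln_gt0; lia.
by case: t t_lt2 e => [|[|//]] _ e; lia.
Qed.

(** * The height of Psi_pqr *)

Theorem theorem1 (p q r alpha beta p' q' : nat)
    (p_prime : prime p) (q_prime : prime q) (r_prime : prime r)
    (p_odd : odd p) (q_odd : odd q) (r_odd : odd r)
    (lt_pq : (p < q)%N) (lt_qr : (q < r)%N)
    (alpha_gt0 : (0 < alpha)%N) (beta_gt0 : (0 < beta)%N)
    (r_eq : r = (alpha * p + beta * q)%N) (r_le : (r <= totient (p * q))%N)
    (p'_range : (1 <= p' <= q - 1)%N) (p'_inv : p * p' = 1 %[mod q])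
    (q'_range : (1 <= q' <= p - 1)%N) (q'_inv : q * q' = 1 %[mod p]) :
  (inv_Cyclotomic_height (p * q * r))%:Z =
  Num.max
    (Num.min (Num.ceil (p'%:R / alpha%:R : rat))
             (Num.ceil (q'%:R / beta%:R : rat)))
    (Num.min (Num.ceil ((q%:R - p'%:R) / alpha%:R : rat))
             (Num.ceil ((p%:R - q'%:R) / beta%:R : rat))).
Proof.
have [p_gt1 q_gt1] := (prime_gt1 p_prime, prime_gt1 q_prime).
have [p_gt0 q_gt0] := (prime_gt0 p_prime, prime_gt0 q_prime).
have neq_pq : p != q by rewrite neq_ltn lt_pq.
have neq_qr : q != r by rewrite neq_ltn lt_qr.
have neq_pr : p != r by rewrite neq_ltn (ltn_trans lt_pq).
have co_pq : coprime p q by rewrite prime_coprime // dvdn_prime2.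
have bez := bezout_modn co_pq p_gt1 q_gt1 p'_range p'_inv q'_range q'_inv.
have [p'_gt0 lt_p'] : (0 < p' /\ p' < q)%N by lia.
have [q'_gt0 lt_q'] : (0 < q' /\ q' < p)%N by lia.
clear p'_range p'_inv q'_range q'_inv r_le p_odd q_odd r_odd.
rewrite -!natrB ?(ltnW lt_p') ?(ltnW lt_q') // !ceil_natr_div ?subn_gt0 //.
have coefE k := @coef_inv_Cyclotomic_pqr p q r p' q' k p_prime q_prime r_prime
  neq_pq neq_pr neq_qr (ltnW lt_p') (ltnW lt_q') bez.
have leA t k : (#|hits p q r p' q' p t k| <= minn (p'.-1 %/ alpha).+1 (q'.-1 %/ beta).+1)%N.
  by rewrite r_eq; apply: card_hits_le => //; rewrite ?p'_gt0 ?q'_gt0 ltnW.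
have leB t k : (#|hits p q r (q - p') (p - q') p t k|
    <= minn ((q - p').-1 %/ alpha).+1 ((p - q').-1 %/ beta).+1)%N.
  by rewrite r_eq; apply: card_hits_le; rewrite ?subn_gt0 ?leq_subr ?lt_p' ?lt_q'.
have disj s s' k : (0 < #|hits p q r p' q' p (r * s) k|)%N ->
    #|hits p q r (q - p') (p - q') p (r * s').+1 k| = 0%N.
  by rewrite r_eq; apply: hits_disjoint => //; exact: ltnW.
have [A defA] : exists A, A = minn (p'.-1 %/ alpha).+1 (q'.-1 %/ beta).+1.
  by eexists.
have [B defB] : exists B,
    B = minn ((q - p').-1 %/ alpha).+1 ((p - q').-1 %/ beta).+1 by eexists.
rewrite -defA in leA; rewrite -defB in leB.
(* These bounds let A - 1 and B - 1 serve as third indices, which range below p, and, as p < q, keep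
   the extremal exponents below the offsets r q and r q + 1. *)
have A_le : (A <= p)%N.
  rewrite defA; apply: leq_trans (geq_minr _ _) _.
  by apply: leq_ltn_trans (leq_div _ _) _; rewrite prednK // ltnW.
have B_le : (B <= p)%N.
  rewrite defB; apply: leq_trans (geq_minr _ _) _.
  by apply: leq_ltn_trans (leq_div _ _) _; rewrite prednK ?subn_gt0 ?leq_subr.
have A_gt0 : (0 < A)%N by rewrite defA leq_min.
have B_gt0 : (0 < B)%N by rewrite defB leq_min.
have geA : (A <= #|hits p q r p' q' p 0 (r * A.-1)|)%N.
  rewrite -[in X in (X <= _)%N](prednK A_gt0) -[(r * A.-1)%N]addn0 r_eq.
  by apply: card_hits_ge; rewrite // ?prednK // -ltnS prednK // ?defA ?defB ?geq_minl ?geq_minr.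
have geB : (B <= #|hits p q r (q - p') (p - q') p 1 (r * B.-1 + 1)|)%N.
  rewrite -[in X in (X <= _)%N](prednK B_gt0) r_eq.
  by apply: card_hits_ge; rewrite ?subn_gt0 // ?prednK // -ltnS prednK // ?defA ?defB ?geq_minl ?geq_minr.
have lt_rA : (r * A.-1 < r * q)%N by rewrite ltn_pmul2l ?prime_gt0 // prednK // (leq_trans A_le) // ltnW.
have lt_rB : (r * B.-1 + 1 < (r * q).+1)%N.
  by rewrite addn1 ltnS ltn_pmul2l ?prime_gt0 // prednK // (leq_trans B_le) // ltnW.
have height : inv_Cyclotomic_height (p * q * r) = maxn A B.
  apply/eqP; rewrite eqn_leq; apply/andP; split.
    apply: poly_height_le => k; rewrite coefE.
    (* By [disj], both counts of one double sum vanish, so the coefficient is a difference of two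
       numbers in [0, A] or of two in [0, B]. *)
    move: (leA 0 k) (leA (r * q)%N k) (leB 1 k) (leB (r * q).+1%N k).
    move: (disj 0 0 k) (disj 0 q k) (disj q 0 k) (disj q q k).
    rewrite !muln0; clear; do 4!move: #|_| => ?; lia.
  rewrite geq_max; apply/andP; split.
    (* Only the count with offset 0 survives, so this coefficient is at most -A. *)
    apply: leq_trans (poly_height_ge _ (r * A.-1)); rewrite coefE.
    move: (disj 0 0 (r * A.-1))%N (disj 0 q (r * A.-1))%N; rewrite !muln0.
    rewrite (hits_eq0 _ _ _ _ _ _ lt_rA).
    move: geA; clear; do 3!move: #|_| => ?; lia.
  (* Only the count with offset 1 survives, so this coefficient is at least B. *)
  apply: leq_trans (poly_height_ge _ (r * B.-1 + 1)); rewrite coefE.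
  move: (disj 0 0 (r * B.-1 + 1))%N (disj q 0 (r * B.-1 + 1))%N; rewrite !muln0.
  rewrite (hits_eq0 _ _ _ _ _ _ lt_rB).
  move: geB; clear; do 3!move: #|_| => ?; lia.
rewrite height defA defB.
clear; do 4!move: (_ %/ _).+1 => ?; lia.
Qed.
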